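(* If $f:X\to Y$ is an open perfect mapping from a topological space $X$ onto a star-$K$-Scheepers space $Y$, then $X$ is star-$K$-Scheepers.
   Context: A perfect mapping is a continuous closed mapping all of whose fibres $f^{-1}(y)$ are compact; an open mapping sends open sets to open sets. For a subset $A$ of a space $Z$ and a collection $\mathcal{P}$ of subsets of $Z$, $St(A,\mathcal{P})=\bigcup\{B\in\mathcal{P}: A\cap B\neq\emptyset\}$. An open cover $\mathcal{U}$ of $Z$ is an $\omega$-cover if each finite $F\subseteq Z$ is contained in some $U\in\mathcal{U}$ (the set $Z$ itself is allowed to be a member). $Z$ is star-$K$-Scheepers if for each sequence $(\mathcal{U}_n)_{n\in\mathbb{N}}$ of open covers of $Z$ there is a sequence $(K_n)_{n\in\mathbb{N}}$ of compact subsets of $Z$ such that $\{St(K_n,\mathcal{U}_n): n\in\mathbb{N}\}$ is an $\omega$-cover of $Z$. *)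

(* Defs.v *)
From mathcomp Require Import all_boot all_classical topology.

Set Implicit Arguments.
Unset Strict Implicit.
Unset Printing Implicit Defensive.

Local Open Scope classical_set_scope.

Definition open_map (X Y : topologicalType) (f : X -> Y) : Prop :=
  forall A : set X, open A -> open (f @` A).

Definition closed_map (X Y : topologicalType) (f : X -> Y) : Prop :=
  forall A : set X, closed A -> closed (f @` A).

(* Surjectivity is not part of the notion. *)
Definition perfect_map (X Y : topologicalType) (f : X -> Y) : Prop :=
  [/\ continuous f, closed_map f & forall y : Y, compact (f @^-1` [set y])].

Definition star (T : Type) (A : set T) (P : set (set T)) : set T :=
  \bigcup_(B in [set B | P B /\ A `&` B !=set0]) B.

Definition open_cover (Z : topologicalType) (U : set (set Z)) : Prop :=
  U `<=` open /\ \bigcup_(B in U) B = [set: Z].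

(* [set: Z] may belong to U. *)
Definition omega_cover (Z : topologicalType) (U : set (set Z)) : Prop :=
  open_cover U /\
  forall F : set Z, finite_set F -> exists2 B, U B & F `<=` B.

(* No separation axiom is assumed: compact sets need not be closed. *)
Definition star_K_Scheepers (Z : topologicalType) : Prop :=
  forall U : nat -> set (set Z), (forall n, open_cover (U n)) ->
  exists2 K : nat -> set Z, (forall n, compact (K n)) &
    omega_cover (range (fun n => star (K n) (U n))).

(* Main.v *)
Require Import Defs.
From mathcomp Require Import all_boot all_classical topology.

(** Let [U] be an open cover of [X].  Call an open [O] in [Y] adapted to [U] if
    there is a subfamily [P] of [U] that covers the preimage of [O] and whose
    members [V] all satisfy [O `<=` f @` V].  Each [y] has an adapted
    neighbourhood: the fiber over [y] is covered by finitely many members of [U]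
    meeting it; intersect their (open) images with the complement of the (closed)
    image of the complement of their union.  If an adapted [O] meets [K], every
    [V] in [P] meets [f @^-1` K]; so the preimage of the star of [K] in the
    adapted cover lies in the star of [f @^-1` K], which is compact, in [U]. *)

Local Open Scope classical_set_scope.

(** The image filter clusters at some [y] in [K]. As [f] is closed, the fiber over [y] meets
    [closure A] for every [A] in [F]; these traces generate a proper filter on the compact fiber,
    and its cluster point is also one of [F]. *)
Lemma compact_preimage_closed_map (X Y : topologicalType) (f : X -> Y)
    (K : set Y) : closed_map f -> (forall y, compact (f @^-1` [set y])) ->
  compact K -> compact (f @^-1` K).
Proof.
move=> f_closed f_fib cK F FF FK.
have [y [Ky yF]] := cK (f @ F) _ FK.
pose C := f @^-1` [set y].
pose G := filter_from F (fun A => C `&` closure A).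
have FG : ProperFilter G.
  apply: filter_from_proper => [|A FA].
    apply: filter_from_filter => [|A B FA FB]; first by exists setT; exact: filterT.
    exists (A `&` B); first exact: filterI.
    by move=> x [Cx /closureI[Ax Bx]].
  have : closure (f @` closure A) y.
    move=> B yB; apply: (yF _ _ _ yB); apply: (@filterS _ F _ A) FA => x Ax.
    by exists x => //; exact: subset_closure.
  rewrite -(iffLR (closure_id _) (f_closed _ (closed_closure (A := A)))).
  by case=> x Ax fx; exists x.
have GC : G C by exists setT; [exact: filterT | move=> x []].
have [x [Cx xG]] := f_fib y G _ GC.
exists x; split; first by rewrite /preimage /= Cx.
move=> A B FA xB.
have GA : G (C `&` closure A) by exists A.
by have [z [[_ Az] /Az]] := xG _ _ GA (nbhs_interior xB).
Qed.

Definition adapted_cover {X Y : topologicalType} (f : X -> Y)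
    (U : set (set X)) : set (set Y) :=
  [set O | open O /\ exists P : set (set X),
    [/\ P `<=` U, f @^-1` O `<=` \bigcup_(V in P) V &
        forall V, P V -> O `<=` f @` V]].

Lemma open_cover_adapted (X Y : topologicalType) (f : X -> Y)
    (U : set (set X)) : open_map f -> closed_map f ->
  (forall y, compact (f @^-1` [set y])) -> open_cover U ->
  open_cover (adapted_cover f U).
Proof.
move=> f_open f_closed f_fib [Uo Uc]; split=> [O []//|].
apply/seteqP; split=> // y _.
(* Stands for the finite families of members of [U] meeting the fiber: all that
   is used of finiteness is the stability under unions. *)
pose good (P : set (set X)) :=
  P `<=` U /\ nbhs y (\bigcap_(V in P) f @` V).
pose C := f @^-1` [set y].
have [P [PU Py] CP] : exists2 P, good P & C `<=` \bigcup_(V in P) V.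
  (* Otherwise the parts of the fiber left uncovered by good families generate a proper filter. Its
     cluster point lies in some [V] of [U], and [[set V]] is good since [f] is open: a
     contradiction. *)
  apply: contrapT => noP.
  pose G := filter_from good (fun P => C `\` \bigcup_(V in P) V).
  have good0 : good set0 by split=> //; rewrite bigcap_set0; exact: filterT.
  have FG : ProperFilter G.
    apply: filter_from_proper => [|P gP].
      apply: filter_from_filter; first by exists set0.
      move=> P Q [PU Py] [QU Qy]; exists (P `|` Q).
        split; first by rewrite subUset.
        by rewrite bigcap_setU; exact: filterI.
      by rewrite bigcup_setU setDUr.
    apply/set0P/eqP => CP; apply: noP; exists P => //.
    by rewrite -setD_eq0.
  have GC : G C by exists set0 => // x [].
  have [x [Cx xG]] := f_fib y G _ GC.
  have : [set: X] x by [].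
  rewrite -Uc => -[V UV Vx].
  have GV : G (C `\` V).
    exists [set V]; last by rewrite bigcup_set1.
    split; first by move=> _ ->.
    rewrite bigcap_set1; apply: open_nbhs_nbhs; split; last by exists x.
    exact: f_open (Uo _ UV).
  have [z [[_ nVz] Vz]] := xG _ _ GV (open_nbhs_nbhs (conj (Uo _ UV) Vx)).
  exact: nVz.
exists ((\bigcap_(V in P) f @` V)° `&` ~` (f @` ~` \bigcup_(V in P) V)).
  split.
    apply: openI; first exact: open_interior.
    apply/closed_openC/f_closed/open_closedC.
    by apply: bigcup_open => V /PU /Uo.
  exists P; split=> // [x [_ nx]|V PV z [/interior_subset zP _]].
    by apply: contrapT => Px; apply: nx; exists x.
  exact: zP.
split=> // -[x Px fx]; exact/Px/CP.
Qed.

Lemma preimage_star_adapted (X Y : topologicalType) (f : X -> Y)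
    (U : set (set X)) (K : set Y) :
  f @^-1` star K (adapted_cover f U) `<=` star (f @^-1` K) U.
Proof.
move=> x [O [[_ [P [PU OP PO]]] [k [Kk Ok]]] Ofx].
have [V PV Vx] := OP x Ofx.
exists V => //; split; first exact: PU.
by have [z Vz fz] := PO V PV k Ok; exists z; split => //; rewrite /preimage /= fz.
Qed.

Lemma open_star (X : topologicalType) (A : set X) (U : set (set X)) :
  U `<=` open -> open (star A U).
Proof. by move=> Uo; apply: bigcup_open => V [/Uo]. Qed.

Theorem theorem4p12 (X Y : topologicalType) (f : X -> Y)
    (f_open : open_map f) (f_perfect : perfect_map f)
    (f_onto : set_surj [set: X] [set: Y] f) :
  star_K_Scheepers Y -> star_K_Scheepers X.
Proof.
move=> YS U Ucov; have [_ f_closed f_fib] := f_perfect.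
have [n|K cK [_ Kom]] := YS (fun n => adapted_cover f (U n)).
  exact: open_cover_adapted.
exists (fun n => f @^-1` K n) => [n|].
  exact: compact_preimage_closed_map.
(* Proved first because its case of singletons gives the covering part of [open_cover]. *)
have om F : finite_set F -> exists2 B,
    range (fun n => star (f @^-1` K n) (U n)) B & F `<=` B.
  move=> finF; have [_ [n _ <-] FB] := Kom _ (finite_image f finF).
  exists (star (f @^-1` K n) (U n)); first by exists n.
  by move=> x Fx; apply/preimage_star_adapted/FB; exists x.
split=> //; split=> [_ [n _ <-]|]; first exact/open_star/(Ucov n).1.
apply/seteqP; split=> // x _.
by have [B rB xB] := om _ (finite_set1 x); exists B => //; exact: xB.
Qed.
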